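(* Let $(G,T,\ell,u,w)$ be a PESP instance, $\mathscr{B}$ an integral cycle basis of $G$ with width $W_{\mathscr{B}}$, and $Z$ the corresponding cycle offset zonotope. Suppose that $W_{\mathscr{B}}\ge 1$. Then $$|\mathscr{S}(G)|\cdot\left(\frac{\varepsilon}{T}\right)^{\mu}\le\operatorname{vol}(Z)\le\prod_{\gamma\in\mathscr{B}}s_\gamma\le W_{\mathscr{B}}\cdot\prod_{\gamma\in\mathscr{B}}\frac{s_\gamma}{\max\{\lfloor s_\gamma\rfloor,1\}}<W_{\mathscr{B}}\cdot 2^{\mu},$$ where $\varepsilon=\min\{u_a-\ell_a\mid a\in A(G)\}$ and $s_\gamma=\sum_{a\in A(G):\gamma_a\ne0}\frac{u_a-\ell_a}{T}$.
   Context: A PESP instance $(G,T,\ell,u,w)$ consists of a finite directed graph $G$ with vertex set $V(G)$ and arc set $A(G)$, a positive integer $T$, and $\ell,u,w\in\mathbb{R}^{A(G)}$. Standing assumptions: $G$ is simple, 2-connected (as an undirected graph, in particular with at least three vertices), has no pair of antiparallel arcs, and $0\le\ell_a<T$, $0<u_a-\ell_a<T$ for all arcs $a$. $\mathscr{S}(G)$ is the set of spanning trees of (the underlying undirected graph of) $G$. $B$ is the incidence matrix of $G$. An oriented cycle is a vector $\gamma\in\{-1,0,1\}^{A(G)}$ with $B\gamma=0$ that is the signed indicator vector of a circuit of the underlying undirected graph; $\gamma_+=\max(\mathbf{0},\gamma)$ and $\gamma_-=\max(\mathbf{0},-\gamma)$ componentwise. The cycle space is the abelian group generated by the oriented cycles;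 its rank is $\mu=|A(G)|-|V(G)|+1$. An integral cycle basis is a tuple $\mathscr{B}=(\gamma_1,\dots,\gamma_\mu)$ of oriented cycles generating the cycle space as a $\mathbb{Z}$-module; its cycle matrix is $\Gamma=(\gamma_1,\dots,\gamma_\mu)^\top$. The cycle offset zonotope is $Z=\{\Gamma x/T\mid\ell\le x\le u\}\subset\mathbb{R}^{\mathscr{B}}$; $\operatorname{vol}$ is Lebesgue measure on $\mathbb{R}^{\mathscr{B}}\cong\mathbb{R}^\mu$. The width of $\mathscr{B}$ is $$W_{\mathscr{B}}=\prod_{\gamma\in\mathscr{B}}\left(\left\lfloor\frac{\gamma_+^\top u-\gamma_-^\top\ell}{T}\right\rfloor-\left\lceil\frac{\gamma_+^\top\ell-\gamma_-^\top u}{T}\right\rceil+1\right).$$ *)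

(* Defs.v *)
From HB Require Import structures.
From mathcomp Require Import all_boot all_order all_algebra.
From mathcomp Require Import all_classical all_reals all_analysis.

Set Implicit Arguments.
Unset Strict Implicit.
Unset Printing Implicit Defensive.

Import Order.TTheory GRing.Theory Num.Theory.

Local Open Scope classical_set_scope.
Local Open Scope ring_scope.

(** R^n is [n.-tuple R] with the library's product sigma-algebra, and the
    measure is the n-fold product of the one-dimensional Lebesgue measure. *)
Fixpoint lebesgue_tuple (R : realType) (n : nat) :
    set (n.-tuple (measurableTypeR R)) -> \bar R :=
  match n with
  | 0 => \d_[tuple]
  | m.+1 => pushforward (product_measure1 lebesgue_measure (@lebesgue_tuple R m))
              (fun p => [tuple of p.1 :: p.2])
  end.

(** Arcs are ordered pairs of vertices, so there are no parallel arcs; loops and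
    antiparallel pairs are excluded separately by [simple_graph]. *)
Record digraph := Digraph {
  vertex : finType;
  arcs : {set vertex * vertex}
}.

Definition arc_type (G : digraph) : finType := {a : vertex G * vertex G | a \in arcs G}.
Definition source (G : digraph) (a : arc_type G) : vertex G := (val a).1.
Definition target (G : digraph) (a : arc_type G) : vertex G := (val a).2.

Definition adj (V : finType) (S : {set V * V}) : rel V :=
  fun x y => ((x, y) \in S) || ((y, x) \in S).

Definition simple_graph (G : digraph) : Prop :=
  forall x : vertex G, (x, x) \notin arcs G.

Definition no_antiparallel (G : digraph) : Prop :=
  forall x y : vertex G, (x, y) \in arcs G -> (y, x) \notin arcs G.

(** The graph with vertex set [~: X] and the edges of [S] that avoid [X]
    is connected. *)
Definition connected_off (V : finType) (S : {set V * V}) (X : {set V}) : Prop :=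
  forall x y : V, x \notin X -> y \notin X ->
    connect [rel a b | [&& adj S a b, a \notin X & b \notin X]] x y.

Definition two_connected (G : digraph) : Prop :=
  (2 < #|vertex G|)%N /\
  forall X : {set vertex G}, (#|X| < 2)%N -> connected_off (arcs G) X.

(** A circuit of the underlying undirected graph, as the set of its arcs: [p]
    lists its vertices in cyclic order. *)
Definition circuit (G : digraph) (C : {set vertex G * vertex G}) : Prop :=
  exists p : seq (vertex G),
    [/\ (2 < size p)%N, ucycle (adj (arcs G)) p &
        C = [set a in arcs G | (a.1 \in p) && (a.2 == next p a.1)
                            || (a.2 \in p) && (a.1 == next p a.2)]].

Definition spanning_tree (G : digraph) (S : {set vertex G * vertex G}) : Prop :=
  [/\ S \subset arcs G, connected_off S finset.set0 &
      forall C, circuit C -> ~~ (C \subset S)].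

Definition spanning_trees (G : digraph) : {set {set vertex G * vertex G}} :=
  [set S | `[< spanning_tree S >]]%SET.

Definition incidence (G : digraph) (v : vertex G) (a : arc_type G) : int :=
  (v == target a)%:Z - (v == source a)%:Z.

Definition arc_vector (G : digraph) : zmodType := {ffun arc_type G -> int}.

Definition oriented_cycle (G : digraph) : set (arc_vector G) :=
  [set g | [/\ forall a, g a \in [:: -1; 0; 1],
               forall v, \sum_a incidence v a * g a = 0 &
               circuit [set val a | a in [set a | g a != 0]%SET]%SET]].
Arguments oriented_cycle : clear implicits.

Definition zspan (M : zmodType) (X : set M) : set M :=
  [set v | exists (n : nat) (x : 'I_n -> M) (k : 'I_n -> int),
     (forall i, X (x i)) /\ v = \sum_(i < n) x i *~ k i].

Definition cycle_space (G : digraph) : set (arc_vector G) :=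
  zspan (oriented_cycle G).
Arguments cycle_space : clear implicits.

(** For connected [G], the natural-number subtraction does not truncate. *)
Definition cyclomatic (G : digraph) : nat := (#|arc_type G| + 1 - #|vertex G|)%N.

Definition integral_cycle_basis (G : digraph)
    (B : (cyclomatic G).-tuple (arc_vector G)) : Prop :=
  (forall i, oriented_cycle G (tnth B i)) /\
  zspan [set` B] = cycle_space G.

Definition pos_part (G : digraph) (g : arc_vector G) (a : arc_type G) : int :=
  Num.max 0 (g a).
Definition neg_part (G : digraph) (g : arc_vector G) (a : arc_type G) : int :=
  Num.max 0 (- g a).

Record pesp (R : realType) := Pesp {
  pesp_graph :> digraph;
  period : nat;
  period_gt0 : (0 < period)%N;
  lower : arc_type pesp_graph -> R;
  upper : arc_type pesp_graph -> R;
  weight : arc_type pesp_graph -> R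
}.

Definition standing_assumptions (R : realType) (P : pesp R) : Prop :=
  [/\ simple_graph P, no_antiparallel P, two_connected P &
      forall a : arc_type P,
        [/\ 0 <= lower a, lower a < (period P)%:R,
            0 < upper a - lower a & upper a - lower a < (period P)%:R]].

Section PespNotions.
Variables (R : realType) (P : pesp R).
Implicit Types (g : arc_vector P) (B : (cyclomatic P).-tuple (arc_vector P)).

Local Notation T := ((period P)%:R : R).

(** Component [i] of Gamma x is the pairing of the [i]-th basis cycle with [x]. *)
Definition zonotope B : set ((cyclomatic P).-tuple (measurableTypeR R)) :=
  [set [tuple (\sum_a (tnth B i a)%:~R * x a) / T | i < cyclomatic P]
     | x in [set x : arc_type P -> R | forall a, lower a <= x a <= upper a]].

Definition width_factor g : int :=
  Num.floor ((\sum_a (pos_part g a)%:~R * upper a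
              - \sum_a (neg_part g a)%:~R * lower a) / T)
  - Num.ceil ((\sum_a (pos_part g a)%:~R * lower a
              - \sum_a (neg_part g a)%:~R * upper a) / T)
  + 1.

Definition width B : int := \prod_(g <- B) width_factor g.

(** The value 0 is for graphs without arcs only. *)
Definition min_span : R :=
  if [pick a : arc_type P] is Some a0
  then \big[Num.min/upper a0 - lower a0]_(a : arc_type P) (upper a - lower a)
  else 0.

Definition cycle_span g : R := \sum_(a | g a != 0) (upper a - lower a) / T.

End PespNotions.

(* Main.v *)
Require Import Defs.
From HB Require Import structures.
From mathcomp Require Import all_boot all_order all_algebra.
From mathcomp Require Import all_classical all_reals all_analysis measurable_realfun.
From mathcomp Require Import ring lra zify.

(** The zonotope lies in the box whose sides are the intervals of possible cycle
    offsets, which have lengths [s_gamma]; an interval of length [s] contains at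
    least [floor s] integers, which compares the box with the width.

    For the lower bound, shrink all intervals to [[l_a, l_a + e]] and fix a generic
    vector [h] on the arcs. A spanning tree [S] determines a half-open
    parallelotope (its cell): each tree arc sits at the end of its interval given
    by the sign of the pairing of [h] with the fundamental cut, and the cotree arcs
    are free. Every point is congruent modulo the lattice [(e/T) Z^mu] to a point of
    the cell, since cotree coordinates can be rounded independently; hence the cell
    has volume at least [(e/T)^mu]. Cells of different trees are disjoint: a
    point of a cell is the offset of exactly one optimal solution of the linear
    program "maximise [h] over the fibre", and the half-open sides are such that
    moving along [h] distinguishes the trees. *)

Set Implicit Arguments.
Unset Strict Implicit.
Unset Printing Implicit Defensive.

Import Order.TTheory GRing.Theory Num.Theory.

Local Open Scope classical_set_scope.
Local Open Scope ring_scope.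

(** * Lebesgue measure on tuples *)

Section LebesgueTuple.
Context {R : realType}.
Local Notation RR := (measurableTypeR R).
Definition tcons n (p : RR * n.-tuple RR) : n.+1.-tuple RR := [tuple of p.1 :: p.2].
Definition tuncons n (t : n.+1.-tuple RR) : RR * n.-tuple RR :=
  (thead t, [tuple of behead t]).

Lemma measurable_tcons n : measurable_fun [set: RR * n.-tuple RR] (@tcons n).
Proof. exact: measurable_cons. Qed.

Lemma measurable_tuncons n : measurable_fun [set: n.+1.-tuple RR] (@tuncons n).
Proof.
apply/measurable_fun_pairP; split; last exact: measurable_behead.
exact: measurable_tnth.
Qed.

Lemma tconsK n : cancel (@tcons n) (@tuncons n).
Proof. by case=> x t; congr pair; exact/val_inj. Qed.

Section Step.
Variables (n : nat) (m : {sigma_finite_measure set (n.-tuple RR) -> \bar R}).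
Let p := pushforward (lebesgue_measure \x m)%E (@tcons n).

Let p0 : p set0 = 0%E. Proof. by apply: measure0; exact: measurable_tcons. Qed.
Let p_ge0 A : (0 <= p A)%E. Proof. by apply: measure_ge0; exact: measurable_tcons. Qed.
Let p_sigma_additive : semi_sigma_additive p.
Proof. by apply: measure_semi_sigma_additive; exact: measurable_tcons. Qed.

HB.instance Definition _ := isMeasure.Build _ _ _ p p0 p_ge0 p_sigma_additive.

Let p_sigma_finite : sigma_finite setT p.
Proof.
have /sigma_finiteP[F [FT Fnd Ffin]] := sigma_finiteT (@lebesgue_measure R).
have /sigma_finiteP[G [GT Gnd Gfin]] := sigma_finiteT m.
exists (fun k => @tuncons n @^-1` (F k `*` G k)) => [|k].
  apply/seteqP; split => // t _.
  have [i _ Fi] : (\bigcup_i F i) (thead t) by rewrite -FT.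
  have [j _ Gj] : (\bigcup_j G j) [tuple of behead t] by rewrite -GT.
  exists (maxn i j) => //; split.
    by move: Fi; apply/subsetPset/Fnd/leq_maxl.
  by move: Gj; apply/subsetPset/Gnd/leq_maxr.
have [mF Foo] := Ffin k; have [mG Goo] := Gfin k; split.
  rewrite -[X in measurable X]setTI; apply: measurable_tuncons => //.
  exact: measurableX.
rewrite /p /pushforward -comp_preimage (_ : _ \o _ = id); last first.
  by apply/funext => x; exact: tconsK.
by rewrite preimage_id product_measure1E // lte_mul_pinfty // ge0_fin_numE.
Qed.

HB.instance Definition _ := Measure_isSigmaFinite.Build _ _ _ p p_sigma_finite.

(** The product needs a bundled sigma-finite second factor, whereas [lebesgue_tuple] is a bare
    fixpoint; an existential over bundled measures can be carried through the induction on the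
    dimension. *)
Lemma pushforward_tcons_sigma_finite_measure :
  exists m' : {sigma_finite_measure set (n.+1.-tuple RR) -> \bar R},
    (m' : set _ -> \bar R) = p.
Proof. by exists p. Qed.

End Step.

Lemma lebesgue_tuple_is_measure n :
  exists m : {sigma_finite_measure set (n.-tuple RR) -> \bar R},
    (m : set _ -> \bar R) = @lebesgue_tuple R n.
Proof.
elim: n => [|n [m mE]]; first by exists (dirac [tuple]).
have [m' m'E] := pushforward_tcons_sigma_finite_measure m.
by exists m'; rewrite m'E /= -mE.
Qed.

Let lebesgue_tuple0 n : @lebesgue_tuple R n set0 = 0%E.
Proof. by have [m <-] := lebesgue_tuple_is_measure n; exact: measure0. Qed.

Let lebesgue_tuple_ge0 n A : (0 <= @lebesgue_tuple R n A)%E.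
Proof. by have [m <-] := lebesgue_tuple_is_measure n; exact: measure_ge0. Qed.

Let lebesgue_tuple_sigma_additive n : semi_sigma_additive (@lebesgue_tuple R n).
Proof.
have [m <-] := lebesgue_tuple_is_measure n; exact: measure_semi_sigma_additive.
Qed.

HB.instance Definition _ n := isMeasure.Build _ _ _ (@lebesgue_tuple R n)
  (@lebesgue_tuple0 n) (@lebesgue_tuple_ge0 n) (@lebesgue_tuple_sigma_additive n).

Let lebesgue_tuple_sigma_finite n : sigma_finite setT (@lebesgue_tuple R n).
Proof. by have [m <-] := lebesgue_tuple_is_measure n; exact: sigma_finiteT. Qed.

HB.instance Definition _ n :=
  Measure_isSigmaFinite.Build _ _ _ (@lebesgue_tuple R n) (@lebesgue_tuple_sigma_finite n).

Lemma lebesgue_tupleS n (A : set (n.+1.-tuple RR)) :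
  lebesgue_tuple A =
  (\int[lebesgue_measure]_x @lebesgue_tuple R n [set t | A (tcons (x, t))])%E.
Proof.
rewrite /= /pushforward /product_measure1; apply: eq_integral => x _ /=.
by congr lebesgue_tuple; apply/seteqP; split => t; rewrite /xsection /= inE.
Qed.

(** No measurability is needed: the integral of a nonnegative function is a supremum
    over the simple functions below it. *)
Lemma le_lebesgue_tuple n (A B : set (n.-tuple RR)) :
  A `<=` B -> (lebesgue_tuple A <= lebesgue_tuple B)%E.
Proof.
elim: n A B => [|n IH] A B AB.
  rewrite /= !diracE lee_fin ler_nat; have [/set_mem /AB At|//] := boolP ([tuple] \in A).
  by rewrite mem_set.
rewrite !lebesgue_tupleS !ge0_integralTE //.
apply: le_ereal_sup => _ [h hA <-]; exists h => //= x.
by apply: le_trans (hA x) _; apply: IH => t; exact: AB.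
Qed.

(** The volume of the section at [x] is constant on the first interval and 0 off it, so the outer
    integral is that of a scaled indicator. *)
Lemma lebesgue_tuple_itv n (I : 'I_n -> interval R) (s : 'I_n -> R) :
  (forall i, @lebesgue_measure R [set` I i] = (s i)%:E) ->
  @lebesgue_tuple R n [set t | forall i, tnth t i \in I i] = (\prod_i s i)%:E.
Proof.
elim: n I s => [|n IH] I s Is.
  rewrite big_ord0 /= diracE mem_set //; by case.
rewrite big_ord_recl lebesgue_tupleS.
transitivity (\int[lebesgue_measure]_x
   ((\prod_(i < n) s (lift ord0 i))%:E * (\1_[set` I ord0] x)%:E))%E.
  apply: eq_integral => x _; rewrite indicE.
  have [xI|xI] := boolP (x \in [set` I ord0]); last first.
    rewrite mule0 (_ : [set t | _] = set0) ?measure0 //.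
    apply/seteqP; split => // t /= /(_ ord0); rewrite tnth0 => xI'.
    by case/negP: xI; exact: mem_set.
  rewrite mule1 -(IH (fun i => I (lift ord0 i))) //.
  congr lebesgue_tuple; apply/seteqP; split => t /= tI i.
    by have := tI (lift ord0 i); rewrite tnthS.
  case: (unliftP ord0 i) => [j|] ->; first by rewrite tnthS.
  by rewrite tnth0; exact: set_mem xI.
rewrite ge0_integralZl //=; last 2 first.
  - apply/measurable_EFinP; exact: measurable_indic.
  - by rewrite lee_fin prodr_ge0 // => i _; rewrite -lee_fin -Is; exact: measure_ge0.
rewrite integral_indic // setIT EFinM muleC; congr (_ * _)%E; exact: Is.
Qed.

Definition tshift n (v t : n.-tuple RR) : n.-tuple RR :=
  [tuple tnth v i + tnth t i | i < n].

Lemma measurable_tshift n (v : n.-tuple RR) : measurable_fun setT (tshift v).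
Proof.
apply/measurable_fun_tnthP => i; rewrite (_ : _ \o _ = fun t => tnth v i + tnth t i).
  by apply: measurable_funD => //; exact: measurable_tnth.
by apply/funext => t /=; rewrite tnth_mktuple.
Qed.

(** By uniqueness of Lebesgue measure it is enough to compare both measures on half-open
    intervals. *)
Lemma lebesgue_measure_shift (a : R) (A : set RR) : measurable A ->
  pushforward lebesgue_measure (fun x : RR => a + x : RR) A = lebesgue_measure A.
Proof.
have ma : measurable_fun setT (fun x : RR => a + x : RR).
  by apply: measurable_funD; [exact: measurable_cst|exact: measurable_id].
move=> mA; apply/esym/lebesgue_measure_unique => //= _ [[b c]] _ <-.
rewrite /pushforward (_ : _ @^-1` _ = `]b - a, c - a]%classic); last first.
  apply/seteqP; split => x /=; rewrite !in_itv /=.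
    by rewrite ltrBlDl lerBrDl.
  by rewrite ltrBlDl lerBrDl.
rewrite !lebesgue_measure_itv /= !lte_fin ltrD2r; case: ifP => // _.
by rewrite -!EFinB; congr EFin; rewrite opprB addrA subrK.
Qed.

Lemma measurable_tcons_section n (A : set (n.+1.-tuple RR)) (x : RR) :
  measurable A -> measurable [set t | A (tcons (x, t))].
Proof.
move=> mA; rewrite -[X in measurable X]setTI.
have : measurable_fun setT (fun t : n.-tuple RR => tcons (x, t)).
  by apply: (measurable_cons (f := cst x)); [exact: measurable_cst|exact: measurable_id].
by move=> /(_ measurableT _ mA).
Qed.

Lemma measurable_fun_tcons_section n (A : set (n.+1.-tuple RR)) :
  measurable A ->
  measurable_fun setT (fun x : RR => @lebesgue_tuple R n [set t | A (tcons (x, t))]).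
Proof.
move=> mA; have mA' : measurable (@tcons n @^-1` A).
  by rewrite -[X in measurable X]setTI; exact: measurable_tcons.
have := measurable_fun_xsection (@lebesgue_tuple R n) mA'.
congr measurable_fun; apply/funext => x /=.
by congr lebesgue_tuple; apply/seteqP; split => t; rewrite /xsection /= inE.
Qed.

(** The induction hypothesis removes the shift of the tail inside each section, and translation
    invariance on the line removes the shift of the first coordinate. *)
Lemma lebesgue_tuple_shift n (v : n.-tuple RR) (A : set (n.-tuple RR)) :
  measurable A -> lebesgue_tuple (tshift v @^-1` A) = lebesgue_tuple A.
Proof.
elim: n v A => [|n IH] v A mA.
  congr lebesgue_tuple; apply/seteqP.
  by split => t; rewrite /preimage /= (tuple0 t) (tuple0 (tshift _ _)).
rewrite !lebesgue_tupleS.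
pose g x := @lebesgue_tuple R n [set t | A (tcons (x, t))].
pose f : RR -> RR := fun x => thead v + x.
have mf : measurable_fun (setT : set RR) f.
  by apply: measurable_funD; [exact: measurable_cst|exact: measurable_id].
transitivity (\int[lebesgue_measure]_x (g \o f) x)%E.
  apply: eq_integral => x _; rewrite /g /=
    -(IH [tuple of behead v] [set t | A (tcons (f x, t))]); last first.
    exact: measurable_tcons_section.
  congr lebesgue_tuple; apply/seteqP.
  have E t : tshift v (tcons (x, t)) = tcons (f x, tshift [tuple of behead v] t).
    apply: eq_from_tnth => i; rewrite tnth_mktuple.
    case: (unliftP ord0 i) => [j|] ->; last by rewrite !tnth0.
    rewrite !tnthS tnth_mktuple tnth_behead; congr (tnth _ _ + _).
    by apply/val_inj => /=; rewrite inordK // ltnS.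
  by split => t; rewrite /preimage /= E.
rewrite -[LHS](@ge0_integral_pushforward _ _ RR RR R f mf lebesgue_measure setT g) //;
  last first.
  exact: measurable_fun_tcons_section.
by apply: eq_measure_integral => //= B mB _; exact: lebesgue_measure_shift.
Qed.

End LebesgueTuple.

Lemma measurable_forall d (T : measurableType d) (I : finType) (F : I -> set T) :
  (forall i, measurable (F i)) -> measurable [set t | forall i, F i t].
Proof.
move=> mF; rewrite (_ : mkset _ = \bigcap_(i in [set: I]) F i).
  by apply: fin_bigcap_measurable => //; exact: finite_finset.
by apply/seteqP; split => t /= Ft i //; exact: Ft.
Qed.

(** * Volume bounds from lattice translates *)

Section Covering.
Context {R : realType}.
Local Notation RR := (measurableTypeR R).

Lemma measurable_tuple_itv n (I : 'I_n -> interval R) :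
  measurable [set t : n.-tuple RR | forall i, tnth t i \in I i].
Proof.
apply: measurable_forall => i; rewrite -[X in measurable X]setTI.
exact: (measurable_tnth i measurableT (measurable_itv (I i))).
Qed.

(** The fundamental cube of the lattice [c Z^n] is covered by translates of the pairwise
    disjoint parts [Q k `&` A] of [A]. *)
Lemma covering_volume n (c : R) (A : set (n.-tuple RR)) : 0 < c -> measurable A ->
  (forall t : n.-tuple RR, exists k : n.-tuple int,
     A (tshift [tuple c * (tnth k i)%:~R | i < n] t)) ->
  ((c ^+ n)%:E <= lebesgue_tuple A)%E.
Proof.
move=> c0 mA Acov.
pose v (k : n.-tuple int) : n.-tuple RR := [tuple c * (tnth k i)%:~R | i < n].
pose Q (k : n.-tuple int) : set (n.-tuple RR) :=
  [set t | forall i, tnth t i \in `[c * (tnth k i)%:~R, c * (tnth k i + 1)%:~R[ ].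
pose k0 : n.-tuple int := [tuple 0 | i < n].
have mQ k : measurable (Q k) by exact: measurable_tuple_itv.
(* Countable additivity concerns sequences, so integer vectors are indexed by natural numbers
   through [pickle]; numbers that encode no vector get the empty set. *)
pose G j := if pickle_inv j is Some k then Q k `&` A else set0.
pose F j := if pickle_inv j is Some k then tshift (v k) @^-1` (Q k `&` A) else set0.
have mG j : measurable (G j).
  by rewrite /G; case: pickle_inv => [k|] //; exact: measurableI.
have mF j : measurable (F j).
  rewrite /F; case: pickle_inv => [k|] //.
  rewrite -[X in measurable X]setTI; apply: measurable_tshift => //.
  exact: measurableI.
have FG j : lebesgue_tuple (F j) = lebesgue_tuple (G j).
  rewrite /F /G; case: pickle_inv => [k|] //.
  by rewrite lebesgue_tuple_shift //; exact: measurableI.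
have Q0 : @lebesgue_tuple R n (Q k0) = (c ^+ n)%:E.
  rewrite (_ : c ^+ n = \prod_(i < n) c); last by rewrite prodr_const card_ord.
  apply: lebesgue_tuple_itv => i.
  rewrite lebesgue_measure_itv /= lte_fin !tnth_mktuple mulr0 mulr1 c0.
  by rewrite -EFinB subr0.
rewrite -Q0; apply: (@le_trans _ _ (\sum_(0 <= j <oo) lebesgue_tuple (F j))%E).
  apply: measure_sigma_subadditive => // t Qt.
  (* The shift that brings [t] into [A] also carries the cube [Q k0] onto [Q k]. *)
  have [k Ak] := Acov t; exists (pickle k) => //.
  rewrite /F pickleK_inv /=; split => // i; rewrite tnth_mktuple.
  have := Qt i; rewrite !in_itv /= !tnth_mktuple mulr0 mulr1 => /andP[t0 tc].
  by rewrite lerDl t0 intrD mulrDr mulr1 ltrD2l.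
under eq_eseriesr do rewrite FG.
(* The cubes are closed below and open above, so a point determines every coordinate of [k]. *)
have disjG : trivIset setT G.
  apply/trivIsetP => i j _ _ ij; apply/seteqP; split => // t [].
  rewrite /G; case: (pickle_inv i) (@pickle_invK (n.-tuple int) i) => [ki|] //= Ei.
  case: (pickle_inv j) (@pickle_invK (n.-tuple int) j) => [kj|] //= Ej.
  move=> [Qi _] [Qj _]; case/eqP: ij; rewrite -Ei -Ej; congr pickle.
  apply: eq_from_tnth => l.
  move: (Qi l) (Qj l); rewrite !in_itv /= => /andP[a1 a2] /andP[b1 b2].
  have := le_lt_trans a1 b2; have := le_lt_trans b1 a2.
  rewrite !ltr_pM2l // !ltr_int !ltzD1 => h1 h2.
  by apply/eqP; rewrite eq_le h1 h2.
rewrite -measure_semi_bigcup //; last exact: bigcupT_measurable.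
apply: le_lebesgue_tuple => t [j _].
by rewrite /G; case: pickle_inv => [k|] // [].
Qed.

End Covering.

(** * Circuits and spanning trees *)

Section Next.
Variables (T : finType) (c : seq T).
Hypothesis uc : uniq c.

(** Length at least three keeps a cyclic walk from traversing an edge in both directions, which
    would make the entries of [walk_vector] cancel. *)
Lemma next_next_neq (x : T) : (2 < size c)%N -> x \in c -> next c (next c x) != x.
Proof.
move=> sc /rot_to[i c' Ec]; rewrite -!(next_rot i uc) Ec.
have : uniq (x :: c') by rewrite -Ec rot_uniq.
have : (2 < size (x :: c'))%N by rewrite -Ec size_rot.
case: c' {Ec} => [|y [|z c']] //= _; rewrite !inE !negb_or eqxx.
by case/and3P => /and3P[xy xz _] _ _; rewrite [y == x]eq_sym (negPf xy) /= eqxx eq_sym.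
Qed.

Lemma sum_next (M : zmodType) (f : T -> M) :
  \sum_(x in c) f (next c x) = \sum_(x in c) f x.
Proof.
rewrite [RHS](reindex (next c)); first by apply: eq_bigl => x; rewrite mem_next.
by exists (prev c) => x _; [exact: prev_next|exact: next_prev].
Qed.

End Next.

Section Graph.
Variable G : digraph.
Hypotheses (simpleG : simple_graph G) (antiG : no_antiparallel G).
Local Notation V := (vertex G).
Local Notation arc := (arc_type G).

Definition tension (M : zmodType) (f : V -> M) (a : arc) : M := f (target a) - f (source a).

Lemma arc_endpoints (a : arc) : val a = (source a, target a).
Proof. by rewrite /source /target -surjective_pairing. Qed.

Lemma arc_valP (a : arc) : (source a, target a) \in arcs G.
Proof. by rewrite -arc_endpoints; exact: valP a. Qed.

Lemma arc_revN (a : arc) : (target a, source a) \notin arcs G.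
Proof. exact: antiG (arc_valP a). Qed.

(** Forward minus backward traversals of each arc. The sum over the vertices of the walk makes
    pairings with tensions telescope. *)
Definition walk_vector (c : seq V) : arc_vector G :=
  [ffun b : arc => \sum_(x in c)
    ((val b == (x, next c x))%:Z - (val b == (next c x, x))%:Z)].

Lemma sum_mem_pred1 (c : seq V) (P : pred V) (x0 : V) :
  (forall x, P x -> x = x0) ->
  \sum_(x in c) (P x)%:Z = ((x0 \in c) && P x0)%:Z :> int.
Proof.
move=> Px; have [xc|xc] := boolP (x0 \in c).
  rewrite (bigD1 x0) //= big1 ?addr0 // => x /andP[_ xx0].
  by case: (boolP (P x)) => // /Px xE; rewrite xE eqxx in xx0.
rewrite big1 // => x xc'; case: (boolP (P x)) => // /Px xE.
by rewrite xE (negPf xc) in xc'.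
Qed.

Lemma walk_vectorE (c : seq V) (b : arc) :
  walk_vector c b = ((source b \in c) && (target b == next c (source b)))%:Z
                    - ((target b \in c) && (source b == next c (target b)))%:Z.
Proof.
rewrite ffunE sumrB; congr (_ - _).
  rewrite (@sum_mem_pred1 _ _ (source b)) => [|x /eqP].
    by rewrite arc_endpoints xpair_eqE eqxx.
  by rewrite arc_endpoints => -[].
rewrite (@sum_mem_pred1 _ _ (target b)) => [|x /eqP].
  by rewrite arc_endpoints xpair_eqE eqxx andbT.
by rewrite arc_endpoints => -[].
Qed.

Lemma walk_vector_tension (c : seq V) (f : V -> int) :
  ucycle (adj (arcs G)) c -> \sum_a tension f a * walk_vector c a = 0.
Proof.
case/andP => cc uc.
under eq_bigr do rewrite ffunE mulr_sumr.
rewrite exchange_big /=.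
transitivity (\sum_(x in c) (f (next c x) - f x)); last first.
  by rewrite sumrB sum_next ?subrr.
(* Without loops and antiparallel arcs, exactly one arc joins [x] and [y], and it counts with sign
   plus. *)
have key x y : (x, y) \in arcs G ->
    \sum_a tension f a * ((val a == (x, y))%:Z - (val a == (y, x))%:Z) = f y - f x.
  move=> xy; rewrite (bigD1 (Sub (x, y) xy : arc)) //= big1 ?addr0.
    rewrite eqxx (negPf (_ : (x, y) != (y, x))) ?subr0 ?mulr1 //.
    apply/eqP => -[xE yE]; move/negP: (simpleG x); apply.
    by rewrite {2}xE.
  move=> a ane; have -> : (val a == (x, y)) = false.
    by apply: contra_neqF ane => /eqP aE; exact/val_inj.
  have -> : (val a == (y, x)) = false.
    by apply/eqP => aE; have := antiG xy; rewrite -aE (valP a).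
  by rewrite subr0 mulr0.
apply: eq_bigr => x xc; have /orP[h|h] := next_cycle cc xc; first exact: key.
rewrite -opprB -(key _ _ h) -sumrN; apply: eq_bigr => a _.
by rewrite -mulrN opprB.
Qed.

Lemma incidenceE (v : V) (a : arc) : incidence v a = tension (fun x => (v == x)%:Z) a.
Proof. by []. Qed.

(** A simple path inside [F] from the head of [a] back to its tail, closed up by [a], is a circuit.
    It has at least three vertices because there are no loops or antiparallel arcs and [a] is not in
    [F]. *)
Lemma cycle_through (F : {set V * V}) (a : arc) :
  F \subset arcs G -> val a \notin F -> connect (adj F) (target a) (source a) ->
  exists g : arc_vector G, [/\ oriented_cycle G g, g a != 0 &
    forall b, g b != 0 -> b = a \/ val b \in F].
Proof.
move=> FA aF /connectP[p0 pF lp]; have := lp.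
case/shortenP: pF => p pF up _ {lp} lp.
set i := source a in lp *; set j := target a in pF up lp *.
pose c := j :: p.
have aij : val a = (i, j) by exact: arc_endpoints.
pose e := [rel x y | adj F x y || ((x, y) == (i, j))].
have ce : cycle e c.
  rewrite /= rcons_path -lp /= eqxx orbT andbT.
  by apply: sub_path pF => x y /= ->.
have eA : subrel e (adj (arcs G)).
  move=> x y /= /orP[/orP[] /(fintype.subsetP FA)|/eqP h]; rewrite /adj.
  - by move=> ->.
  - by move=> ->; rewrite orbT.
  - by rewrite h -aij (valP a).
have ucA : ucycle (adj (arcs G)) c by apply/andP; split=> //; exact: sub_cycle ce.
have sc : (2 < size c)%N.
  rewrite /c; case: (p) pF lp => [_ /= ij|y [|//]] /=.
    by move: (valP a); rewrite /= aij ij (negPf (simpleG j)).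
  rewrite andbT => jy iy; move: jy; rewrite -iy => /orP[ji|]; last by rewrite -aij (negPf aF).
  by move: (fintype.subsetP FA _ ji); rewrite (negPf (arc_revN a)).
have both b : ~~ [&& source b \in c, target b == next c (source b)
    & (target b \in c) && (source b == next c (target b))].
  apply/negP => /and4P[h1 /eqP h2 _ /eqP h3].
  by have := next_next_neq up sc h1; rewrite -h2 -h3 eqxx.
have supp b : (walk_vector c b != 0) =
    ((source b \in c) && (target b == next c (source b))
     || (target b \in c) && (source b == next c (target b))).
  have neq (m n : bool) : ~~ (m && n) -> (m%:Z - n%:Z != 0) = m || n.
    by case: m; case: n.
  by rewrite walk_vectorE; apply: neq; rewrite -andbA; exact: both.
exists (walk_vector c); split.
- split.
  + move=> b; rewrite walk_vectorE; case: (_ && _); case: (_ && _);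
    by rewrite !inE.
  + move=> v; under eq_bigr do rewrite incidenceE; exact: walk_vector_tension.
  + exists c; split => //; apply/setP => b; apply/imsetP/idP.
      by case=> b'; rewrite !inE supp => h ->; rewrite (valP b').
    rewrite inE => /andP[bA h]; exists (Sub b bA : arc) => //.
    by rewrite inE supp.
- rewrite supp -/i -/j; apply/orP; left.
  have ic : i \in c by rewrite lp mem_last.
  (* The tail of [a] is the last vertex of [c], so [next] falls through to the default value of
     [nth], the first vertex, which is the head of [a]. *)
  by rewrite ic andTb next_nth ic /c lp index_last // nth_default.
- move=> b; rewrite supp => /orP[] /andP[bc /eqP bn].
    have := next_cycle ce bc; rewrite -bn => /orP[/orP[h|h]|/eqP h].
    + by right; rewrite arc_endpoints.
    + by move: (fintype.subsetP FA _ h); rewrite (negPf (arc_revN b)).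
    + by left; apply: val_inj; rewrite aij -h arc_endpoints.
  have := next_cycle ce bc; rewrite -bn => /orP[/orP[h|h]|/eqP h].
  + by move: (fintype.subsetP FA _ h); rewrite (negPf (arc_revN b)).
  + by right; rewrite arc_endpoints.
  + by have := arc_revN b; rewrite h -aij (valP a).
Qed.

End Graph.

(** * Fundamental cuts and tensions of a spanning tree *)

Section SpanningTree.
Variable G : digraph.
Hypotheses (simpleG : simple_graph G) (antiG : no_antiparallel G).
Local Notation V := (vertex G).
Local Notation arc := (arc_type G).
Variables (R : realFieldType) (S : {set V * V}).
Hypothesis treeS : spanning_tree S.

Lemma adj_sym (F : {set V * V}) : symmetric (adj F).
Proof. by move=> x y; rewrite /adj orbC. Qed.

Let notin0 (x : V) : x \notin finset.set0. Proof. by rewrite inE. Qed.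

Definition cut_side (b : arc) : pred V := connect (adj (S :\ val b)%SET) (target b).

Lemma in_cut_side (b : arc) (v : V) :
  (v \in cut_side b) = connect (adj (S :\ val b)%SET) (target b) v.
Proof. by []. Qed.

(** For a tree arc [b] this is the signed indicator of its fundamental cut: 1 on arcs entering the
    side of the head of [b], -1 on arcs leaving it. *)
Definition fund_cut (b a : arc) : R := tension (fun v => (v \in cut_side b)%:R) a.

(** If the tail of [b] were still reachable without [b], closing that path by [b] would give a
    circuit inside the tree. *)
Lemma fund_cut_diag (b : arc) : val b \in S -> fund_cut b b = 1.
Proof.
have [SA _ acyc] := treeS.
move=> bS; rewrite /fund_cut /tension !in_cut_side connect0.
have [con|_] := boolP (connect _ _ _); last by rewrite subr0.
have [||g [[_ _ circ] gb0 gS]] := cycle_through simpleG antiG _ _ con.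
- by apply: fintype.subset_trans SA; exact: finset.subsetDl.
- by rewrite !inE eqxx.
case/negP: (acyc _ circ); apply/fintype.subsetP => _ /imsetP[a + ->].
by rewrite inE => /gS[->|] //; rewrite inE => /andP[].
Qed.

Lemma fund_cut_tree (b a : arc) : val a \in S -> a != b -> fund_cut b a = 0.
Proof.
move=> aS ab; rewrite /fund_cut /tension !in_cut_side.
have e : adj (S :\ val b)%SET (source a) (target a).
  by rewrite /adj -arc_endpoints !inE aS (inj_eq val_inj) ab.
rewrite (same_connect_r _ (connect1 e)) ?subrr //.
exact/sym_connect_sym/adj_sym.
Qed.

(** The combination of fundamental cuts whose tension is [x] on the tree. *)
Definition potential (x : arc -> R) (v : V) : R :=
  \sum_(b | val b \in S) x b * (v \in cut_side b)%:R.

Lemma tension_potential (x : arc -> R) (a : arc) :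
  tension (potential x) a = \sum_(b | val b \in S) x b * fund_cut b a.
Proof. by rewrite /tension -sumrB; apply: eq_bigr => b _; rewrite -mulrBr. Qed.

Lemma tension_potential_tree (x : arc -> R) (a : arc) :
  val a \in S -> tension (potential x) a = x a.
Proof.
move=> aS; rewrite tension_potential (bigD1 a) //= fund_cut_diag // mulr1 big1 ?addr0 //.
by move=> b /andP[_ ba]; rewrite fund_cut_tree ?mulr0 // eq_sym.
Qed.

(** The tree connects all vertices, so a function constant along its arcs is constant. *)
Lemma tension_tree0 (p : V -> R) :
  (forall a, val a \in S -> tension p a = 0) -> forall a, tension p a = 0.
Proof.
have [SA conn _] := treeS.
move=> p0 a; rewrite /tension.
have step x y : adj S x y -> p x = p y.
  have st u v : (u, v) \in S -> p u = p v.
    move=> uvS; have uvA := fintype.subsetP SA _ uvS.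
    by have := p0 (Sub (u, v) uvA) uvS; rewrite /tension /source /target /= => /subr0_eq.
  by case/orP => /st.
have /connectP[q qp ->] := conn (source a) (target a) (notin0 _) (notin0 _).
elim: q (source a) qp => [|y q IH] x /=; first by rewrite subrr.
by case/andP => /andP[/step -> _]; exact: IH.
Qed.

(** Both sides are tensions that agree on the tree, hence everywhere: the fundamental cuts generate
    all tensions. *)
Lemma tensionE (p : V -> R) (a : arc) :
  tension p a = \sum_(b | val b \in S) tension p b * fund_cut b a.
Proof.
rewrite -tension_potential; apply/eqP; rewrite -subr_eq0; apply/eqP.
have E b : tension p b - tension (potential (tension p)) b =
    tension (fun v => p v - potential (tension p) v) b.
  by rewrite /tension; ring.
rewrite E; apply: tension_tree0 => b bS.
by rewrite -E tension_potential_tree // subrr.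
Qed.

(** Summation by parts gives a sum over vertices of [p v] times the net flow of [g] at [v], which is
    0. *)
Lemma cycle_tension (g : arc_vector G) (p : V -> R) :
  oriented_cycle G g -> \sum_a (g a)%:~R * tension p a = 0.
Proof.
move=> [_ gdiv _].
transitivity (\sum_a \sum_v p v * (incidence v a * g a)%:~R).
  apply: eq_bigr => a _; rewrite /tension /incidence.
  under eq_bigr do rewrite intrM mulrA.
  rewrite -mulr_suml mulrC; congr (_ * _).
  under eq_bigr do rewrite intrB mulrBr.
  rewrite sumrB; congr (_ - _).
    rewrite (bigD1 (target a)) //= eqxx mulr1 big1 ?addr0 // => v /negPf ->.
    by rewrite mulr0.
  rewrite (bigD1 (source a)) //= eqxx mulr1 big1 ?addr0 // => v /negPf ->.
  by rewrite mulr0.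
rewrite exchange_big big1 // => v _.
by rewrite -mulr_sumr -(raddf_sum (intmul 1)) gdiv mulr0.
Qed.

(** Both sides agree on the tree. A cotree arc [a] closes a cycle whose other arcs are in the tree,
    so pairing this cycle with the difference of the sides leaves only a nonzero multiple of the
    term at [a]. *)
Lemma cycle_orthogonal (x : arc -> R) :
  (forall g, oriented_cycle G g -> \sum_a (g a)%:~R * x a = 0) ->
  forall a, x a = tension (potential x) a.
Proof.
have [SA conn _] := treeS.
move=> ortho a; have [aS|aS] := boolP (val a \in S); first by rewrite tension_potential_tree.
have con : connect (adj S) (target a) (source a).
  have := conn (target a) (source a) (notin0 _) (notin0 _).
  by apply: connect_sub => u v /= /andP[uv _]; exact: connect1.
have [g [gc ga gS]] := cycle_through simpleG antiG SA aS con.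
have : \sum_b (g b)%:~R * (x b - tension (potential x) b) = 0.
  under eq_bigr do rewrite mulrBr.
  by rewrite sumrB ortho // cycle_tension // subrr.
rewrite (bigD1 a) //= big1 ?addr0 => [/eqP|b ba].
  by rewrite mulf_eq0 intr_eq0 (negPf ga) /= subr_eq0 => /eqP.
have [->|/gS[bE|bS]] := eqVneq (g b) 0; first by rewrite mul0r.
  by rewrite bE eqxx in ba.
by rewrite tension_potential_tree // subrr mulr0.
Qed.

(** This is the form that [generic_vector] asks for. The potential depends on tree arcs only, so the
    coefficient at [a] itself is 1. *)
Lemma cotree_slack_linear (a : arc) : val a \notin S ->
  exists c : arc -> R, c a != 0 /\
    forall x : arc -> R, x a - tension (potential x) a = \sum_b c b * x b.
Proof.
move=> aS; exists (fun b => (b == a)%:R - (val b \in S)%:R * fund_cut b a); split.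
  by rewrite eqxx (negPf aS) mul0r subr0 oner_eq0.
move=> x; under eq_bigr do rewrite mulrBl.
rewrite sumrB tension_potential; congr (_ - _).
  rewrite (bigD1 a) //= eqxx mul1r big1 ?addr0 // => b /negPf ->.
  by rewrite mul0r.
rewrite big_mkcond /=; apply: eq_bigr => b _.
by case: ifP; rewrite ?mul0r // mul1r mulrC.
Qed.

Variable h : arc -> R.

Lemma pairing_tension (p : V -> R) :
  \sum_a h a * tension p a = \sum_(b | val b \in S) tension p b * \sum_a h a * fund_cut b a.
Proof.
under eq_bigr do rewrite tensionE mulr_sumr.
rewrite exchange_big; apply: eq_bigr => b _; rewrite mulr_sumr.
by apply: eq_bigr => a _; rewrite mulrCA.
Qed.

Hypothesis hgen : forall b, val b \in S -> \sum_a h a * fund_cut b a != 0.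

Definition cut_sign (b : arc) : bool := 0 < \sum_a h a * fund_cut b a.

(** Expanded in fundamental cuts, the pairing is a sum of nonnegative terms. Genericity of [h] makes
    every coefficient nonzero, so a zero sum forces the tension to vanish on the tree. This
    certifies optimality of a tree solution and its uniqueness. *)
Lemma pairing_ge0 (p : V -> R) :
  (forall b, val b \in S -> if cut_sign b then 0 <= tension p b else tension p b <= 0) ->
  0 <= \sum_a h a * tension p a ?= iff [forall a, tension p a == 0].
Proof.
move=> psign; rewrite pairing_tension.
have term b : val b \in S -> 0 <= tension p b * \sum_a h a * fund_cut b a.
  move=> bS; have := psign b bS; rewrite /cut_sign; case: ltrP => hb pb.
    by rewrite mulr_ge0 // ltW.
  by rewrite mulr_le0.
split; first exact: sumr_ge0.
apply/eqP/forallP => [/esym/eqP|p0]; last first.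
  by rewrite big1 // => b _; rewrite (eqP (p0 b)) mul0r.
rewrite psumr_eq0 // => /allP all0 a; apply/eqP; apply: tension_tree0 => b bS.
have := all0 b (mem_index_enum b); rewrite bS /= mulf_eq0 (negPf (hgen bS)) orbF.
by move/eqP.
Qed.

End SpanningTree.

(** * Cycle offsets *)

Lemma poly_nonroot (R : numFieldType) (p : {poly R}) : p != 0 -> exists x, ~~ root p x.
Proof.
move=> p0; pose s : seq R := [seq i%:R | i <- iota 0 (size p)].
have us : uniq s by rewrite map_inj_uniq ?iota_uniq // => i j /eqP; rewrite eqr_nat => /eqP.
have [ps|/allPn[x _ px]] := boolP (all (root p) s); last by exists x.
by have := max_poly_roots p0 ps us; rewrite size_map size_iota ltnn.
Qed.

(** [h] is taken on the moment curve: each functional becomes a nonzero polynomial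
    in the parameter. *)
Lemma generic_vector (R : numFieldType) (I J : finType) (P : pred J)
    (phi : J -> (I -> R) -> R) :
  (forall j, P j -> exists c : I -> R, (exists i, c i != 0) /\
     forall x, phi j x = \sum_i c i * x i) ->
  exists h : I -> R, forall j, P j -> phi j h != 0.
Proof.
move=> lin; have /choice[c cP] : forall j, exists c : I -> R, P j ->
    (exists i, c i != 0) /\ forall x, phi j x = \sum_i c i * x i.
  move=> j; have [/lin[c cP]|_] := boolP (P j); first by exists c.
  by exists (fun=> 0).
pose q j : {poly R} := \sum_i c j i *: 'X^(enum_rank i).
(* A non-root of the product serves all functionals at once; distinct exponents keep the
   coefficients of each [q j] apart. *)
have qP : \prod_(j | P j) q j != 0.
  apply/prodf_neq0 => j /cP[[i ci] _]; apply: contra_neq ci => q0.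
  have := coef0 R (enum_rank i); rewrite -q0 coef_sum (bigD1 i) //= big1 ?addr0.
    by rewrite coefZ coefXn eqxx mulr1.
  move=> k ki; rewrite coefZ coefXn; case: eqP => [/val_inj/enum_rank_inj ik|].
    by rewrite ik eqxx in ki.
  by rewrite mulr0.
have [x xP] := poly_nonroot qP.
exists (fun i => x ^+ enum_rank i) => j Pj; have [_ ->] := cP j Pj.
move: xP; rewrite rootE horner_prod => /prodf_neq0 /(_ j Pj); apply: contra_neq => <-.
by rewrite horner_sum; apply: eq_bigr => i _; rewrite hornerZ hornerXn.
Qed.

(** * The linear map of cycle offsets *)

Section Kernel.
Variables (R : realType) (G : digraph).
Hypotheses (simpleG : simple_graph G) (antiG : no_antiparallel G).
Local Notation V := (vertex G).
Local Notation arc := (arc_type G).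
Local Notation n := (cyclomatic G).
Variable B : n.-tuple (arc_vector G).
Hypothesis hB : integral_cycle_basis B.
Variable S : {set V * V}.
Hypothesis treeS : spanning_tree S.
Hypothesis V0 : (0 < #|V|)%N.

Definition offset (i : 'I_n) (x : arc -> R) : R := \sum_a (tnth B i a)%:~R * x a.

Lemma offsetB i x y : offset i (fun a => x a - y a) = offset i x - offset i y.
Proof. by rewrite /offset -sumrB; apply: eq_bigr => a _; rewrite mulrBr. Qed.

Lemma offsetD i x y : offset i (fun a => x a + y a) = offset i x + offset i y.
Proof. by rewrite /offset -big_split; apply: eq_bigr => a _; rewrite mulrDr. Qed.

Lemma offset_tension i (p : V -> R) : offset i (tension p) = 0.
Proof. by apply: cycle_tension; apply hB. Qed.

(** The basis generates every oriented cycle, so [x] is orthogonal to all of them and is therefore a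
    tension. *)
Lemma offset_ker (x : arc -> R) :
  (forall i, offset i x = 0) -> forall a, x a = tension (potential S x) a.
Proof.
move=> x0; apply: cycle_orthogonal => // g gc.
have [m [y [k [yB ->]]]] : zspan [set` B] g.
  have [_ ->] := hB.
  exists 1, (fun=> g), (fun=> 1); split=> //.
  by rewrite big_ord1 mulr1z.
transitivity (\sum_(i < m) (k i)%:~R * \sum_a (y i a)%:~R * x a).
  under eq_bigr do rewrite sum_ffunE -[_%:~R]/(intmul 1 _) rmorph_sum mulr_suml.
  rewrite exchange_big; apply: eq_bigr => i _; rewrite mulr_sumr.
  apply: eq_bigr => a _; rewrite mulrA; congr (_ * _).
  by rewrite ffunMzE rmorphMz /= -mulrzl.
rewrite big1 // => i _; have /tnthP[j ->] : y i \in B by exact: yB.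
by rewrite -/(offset j x) x0 mulr0.
Qed.

Lemma offset_inj (x y : arc -> R) :
  (forall i, offset i x = offset i y) -> (forall a, val a \in S -> x a = y a) -> x =1 y.
Proof.
move=> xy xyS a; apply/eqP; rewrite -subr_eq0; apply/eqP.
have E := @offset_ker (fun a => x a - y a).
rewrite E => [|i]; last by rewrite offsetB xy subrr.
apply: (tension_tree0 treeS) => b bS; rewrite -E ?xyS ?subrr // => i.
by rewrite offsetB xy subrr.
Qed.

Lemma sum_indicator (f : V -> R) (w : V) : \sum_v f v * (v == w)%:R = f w.
Proof.
rewrite (bigD1 w) //= eqxx mulr1 big1 ?addr0 // => v /negPf ->.
by rewrite mulr0.
Qed.

(** A rank count: the kernel of the cycle matrix consists of tensions, a space of dimension below
    [#|V|], so the matrix has full row rank. The right inverse [L] is explicit so that preimages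
    depend linearly on [t]. *)
Lemma offset_surj : exists L : arc -> 'I_n -> R, forall (t : 'I_n -> R) i,
  offset i (fun a => \sum_j L a j * t j) = t i.
Proof.
pose Gm : 'M[R]_(n, #|arc|) := \matrix_(i, j) (tnth B i (enum_val j))%:~R.
pose D : 'M[R]_(#|V|, #|arc|) := \matrix_(v, j)
  ((enum_val v == target (enum_val j))%:R - (enum_val v == source (enum_val j))%:R).
(* The rows of the incidence matrix add up to zero. *)
have rankD : (\rank D < #|V|)%N.
  rewrite ltn_neqAle rank_leq_row andbT; apply/negP => freeD.
  have D0 : const_mx 1 *m D = 0 :> 'rV_#|arc|.
    apply/rowP => j; rewrite !mxE.
    under eq_bigr do rewrite !mxE mulrBr.
    rewrite -(big_enum_val (fun v => 1 * (v == target (enum_val j))%:R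
                                     - 1 * (v == source (enum_val j))%:R)) /=.
    by rewrite sumrB !(sum_indicator (fun=> 1)) subrr.
  have /rowP/(_ (Ordinal V0)) : const_mx 1 = 0 :> 'rV[R]_#|V|.
    by apply: (row_free_inj freeD); rewrite mul0mx.
  by rewrite !mxE => /eqP; rewrite oner_eq0.
have kerD : (kermx Gm^T <= D)%MS.
  apply/row_subP => k; set u := row k _.
  pose x a := u 0 (enum_rank a).
  have x0 i : offset i x = 0.
    have : (u *m Gm^T) 0 i = 0 by rewrite -row_mul mulmx_ker row0 mxE.
    rewrite mxE => <-; rewrite /offset (reindex_onto enum_val enum_rank) /=; last first.
  by move=> a _; rewrite enum_rankK.
    apply: eq_big => [j|j _]; first by rewrite enum_valK eqxx.
    by rewrite [Gm^T _ _]mxE [Gm _ _]mxE /x enum_valK mulrC.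
  suff -> : u = (\row_v potential S x (enum_val v)) *m D by exact: submxMl.
  apply/rowP => j; rewrite -[LHS](_ : x (enum_val j) = _); last by rewrite /x enum_valK.
  rewrite (offset_ker x0) mxE /tension.
  under eq_bigr do rewrite !mxE mulrBr.
  pose p := potential S x.
  rewrite -(big_enum_val (fun v => p v * (v == target (enum_val j))%:R
                                   - p v * (v == source (enum_val j))%:R)) /=.
  by rewrite sumrB !sum_indicator.
have freeG : row_free Gm.
  rewrite /row_free eqn_leq rank_leq_row /= [leqLHS]/cyclomatic.
  have := mxrankS kerD; rewrite mxrank_ker mxrank_tr => h.
  move: rankD h; move: (\rank D) (\rank Gm) => r r'; lia.
have /row_freeP[L GL] := freeG.
exists (fun a j => L (enum_rank a) j) => t i.
transitivity ((Gm *m L *m (\col_j t j)) i 0); last by rewrite GL mul1mx mxE.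
rewrite -mulmxA mxE /offset (reindex_onto enum_val enum_rank) /=; last first.
  by move=> a _; rewrite enum_rankK.
apply: eq_big => [j|j _]; first by rewrite enum_valK eqxx.
by rewrite !mxE enum_valK; congr (_ * _); apply: eq_bigr => k _; rewrite mxE.
Qed.

End Kernel.

(** * Spanning tree cells *)

Section Cells.
Variables (R : realType) (G : digraph).
Hypotheses (simpleG : simple_graph G) (antiG : no_antiparallel G).
Hypothesis V0 : (0 < #|vertex G|)%N.
Local Notation V := (vertex G).
Local Notation arc := (arc_type G).
Local Notation n := (cyclomatic G).
Local Notation RR := (measurableTypeR R).
Variable B : n.-tuple (arc_vector G).
Hypothesis hB : integral_cycle_basis B.
Variables (T e : R) (l h : arc -> R).
Hypotheses (T0 : 0 < T) (e0 : 0 < e).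
Implicit Types S : {set V * V}.

(** The reduced cost of a cotree arc: the value of [h] on its fundamental cycle, oriented along
    [a]. *)
Definition slack S (a : arc) : R := h a - tension (potential S h) a.

Hypothesis cut_gen : forall S b, spanning_tree S -> val b \in S ->
  \sum_a h a * fund_cut R S b a != 0.
Hypothesis slack_gen : forall S a, spanning_tree S -> val a \notin S -> slack S a != 0.

Definition tree_value S (a : arc) : R := l a + (if cut_sign S h a then e else 0).

(** The side is such that moving slightly in the direction [slack S] stays in the
    interval. *)
Definition cotree_itv S (a : arc) : interval R :=
  if 0 < slack S a then `[l a, l a + e[ else `]l a, l a + e].

Definition in_cell S (x : arc -> R) : Prop := forall a,
  if val a \in S then x a = tree_value S a else x a \in cotree_itv S a.

Definition cell S : set (n.-tuple RR) :=
  [set t | exists2 x : arc -> R, in_cell S x & forall i, offset B i x = T * tnth t i].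

Lemma in_cell_bound S x a : in_cell S x -> l a <= x a <= l a + e.
Proof.
move/(_ a); rewrite /tree_value /cotree_itv; case: ifP => _.
  by case: ifP => _ ->; rewrite ?addr0 lexx ?lerDl ?andbT ltW.
by case: ifP => _; rewrite in_itv /= => /andP[h1 h2]; rewrite ?h1 ?h2 ltW.
Qed.

Lemma slack_tree S a : spanning_tree S -> val a \in S -> slack S a = 0.
Proof. by move=> hS aS; rewrite /slack tension_potential_tree ?subrr. Qed.

Lemma tensionN (p : V -> R) a : tension (fun v => - p v) a = - tension p a.
Proof. by rewrite /tension opprD. Qed.

(** Optimality in both directions: the hypotheses on [S] and [S'] bound the pairing of
    [h] with the tension of [p] by 0 from below and from above. *)
Lemma tension_eq0 S S' (p : V -> R) : spanning_tree S -> spanning_tree S' ->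
  (forall b, val b \in S -> if cut_sign S h b then 0 <= tension p b else tension p b <= 0) ->
  (forall b, val b \in S' -> if cut_sign S' h b then tension p b <= 0 else 0 <= tension p b) ->
  forall a, tension p a = 0.
Proof.
move=> hS hS' pS pS' a.
have [ge0 eq0] := pairing_ge0 simpleG antiG hS (fun b => @cut_gen S b hS) pS.
have [] := pairing_ge0 simpleG antiG hS' (fun b => @cut_gen S' b hS') (p := fun v => - p v).
  move=> b /pS'; case: ifP => _; rewrite tensionN.
    by rewrite oppr_ge0.
  by rewrite oppr_le0.
under eq_bigr do rewrite tensionN mulrN.
rewrite sumrN oppr_ge0 => le0 _.
have /eqP s0 : \sum_a h a * tension p a == 0 by rewrite eq_le le0.
by move: eq0; rewrite s0 eqxx => /esym/forallP/(_ a)/eqP.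
Qed.

(** The difference is a tension. On [S] the vector [x] sits at the ends favoured by [h], and on [S']
    the vector [x'] does, which gives the two sign conditions of [tension_eq0]. *)
Lemma in_cell_point_unique S S' x x' : spanning_tree S -> spanning_tree S' ->
  in_cell S x -> in_cell S' x' -> (forall i, offset B i x = offset B i x') -> x =1 x'.
Proof.
move=> hS hS' xS xS' xx' a; apply/eqP; rewrite -subr_eq0; apply/eqP.
have E := offset_ker simpleG antiG hB hS (x := fun a => x a - x' a).
have {}E b := E (fun i => _) b.
rewrite E; last by move=> i; rewrite offsetB xx' subrr.
apply: (tension_eq0 hS hS') => b bS; rewrite -E; try by move=> i; rewrite offsetB xx' subrr.
  have := xS b; rewrite bS /tree_value => ->.
  have /andP[] := in_cell_bound b xS'; case: (cut_sign S h b); rewrite ?addr0.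
    by rewrite subr_ge0.
  by rewrite subr_le0.
have := xS' b; rewrite bS /tree_value => ->.
have /andP[] := in_cell_bound b xS; case: (cut_sign S' h b); rewrite ?addr0.
  by rewrite subr_le0.
by rewrite subr_ge0.
Qed.

(** If [b] is a cotree arc of [S'], then [x b] is an end that belongs to the half-open interval of
    [S']; which end is included reveals the sign of [slack S' b]. *)
Lemma in_cell_slack S S' x b : spanning_tree S' -> in_cell S x -> in_cell S' x ->
  val b \in S -> if cut_sign S h b then slack S' b <= 0 else 0 <= slack S' b.
Proof.
move=> hS' xS xS' bS.
have [bS'|bS'] := boolP (val b \in S'); first by rewrite slack_tree // lexx; case: ifP.
have := xS' b; have := xS b; rewrite bS (negPf bS') /cotree_itv /tree_value => ->.
case: (cut_sign S h b); case: ltrP => // s0; rewrite in_itv /= ?addr0 ?ltxx ?andbF // => _.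
exact: ltW.
Qed.

(** The two slack vectors differ by a tension whose signs on both trees come from [in_cell_slack],
    so they coincide. By genericity a slack vanishes exactly on its tree, which recovers the
    tree. *)
Lemma in_cell_tree_unique S S' x : spanning_tree S -> spanning_tree S' ->
  in_cell S x -> in_cell S' x -> S = S'.
Proof.
move=> hS hS' xS xS'.
pose q v := potential S' h v - potential S h v.
have qE a : tension q a = slack S a - slack S' a by rewrite /slack /tension /q; ring.
have q0 : forall a, tension q a = 0.
  apply: (tension_eq0 hS hS') => b bS; rewrite qE (slack_tree _ bS) // ?subr0 ?sub0r.
    by have := in_cell_slack hS' xS xS' bS; case: ifP => _; rewrite ?oppr_ge0 ?oppr_le0.
  by have := in_cell_slack hS xS' xS bS; case: ifP.
have mem_eq (a : arc) : (val a \in S) = (val a \in S').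
  have sE : slack S a = slack S' a by apply/eqP; rewrite -subr_eq0 -qE q0.
  apply/idP/idP => aS; apply: contraLR isT => aS'.
    by have := slack_gen hS' aS'; rewrite -sE slack_tree ?eqxx.
  by have := slack_gen hS aS'; rewrite sE slack_tree ?eqxx.
have [/fintype.subsetP SA _ _] := hS; have [/fintype.subsetP SA' _ _] := hS'.
apply/setP => u; have [uA|uA] := boolP (u \in arcs G).
  exact: (mem_eq (Sub u uA)).
by rewrite (contraNF (SA u) uA) (contraNF (SA' u) uA).
Qed.

Lemma cell_tree_unique S S' t : spanning_tree S -> spanning_tree S' ->
  cell S t -> cell S' t -> S = S'.
Proof.
move=> hS hS' [x xS xt] [x' xS' x't].
have xx' : x =1 x' by apply: (in_cell_point_unique hS hS' xS xS') => i; rewrite xt x't.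
apply: (in_cell_tree_unique hS hS' xS) => a; rewrite xx'; exact: xS'.
Qed.

(** The first sum is a preimage of the offsets given by the right inverse [L]; the second adds the
    tension that moves the tree arcs to their prescribed values without changing offsets. The
    formula is affine in [t], hence measurable. *)
Definition cell_point S (L : arc -> 'I_n -> R) (t : n.-tuple RR) (a : arc) : R :=
  \sum_j L a j * (T * tnth t j)
  + \sum_(b | val b \in S) (tree_value S b - \sum_j L b j * (T * tnth t j)) * fund_cut R S b a.

Lemma cell_pointP S L t : spanning_tree S ->
  (forall (t : 'I_n -> R) i, offset B i (fun a => \sum_j L a j * t j) = t i) ->
  (forall i, offset B i (cell_point S L t) = T * tnth t i) /\
  (forall a, val a \in S -> cell_point S L t a = tree_value S a).
Proof.
move=> hS LP.
have E a : cell_point S L t a = \sum_j L a j * (T * tnth t j) +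
    tension (potential S (fun b => tree_value S b - \sum_j L b j * (T * tnth t j))) a.
  by rewrite tension_potential.
split=> [i|a aS]; last by rewrite E tension_potential_tree // addrC subrK.
transitivity (offset B i (fun a => \sum_j L a j * (T * tnth t j) +
    tension (potential S (fun b => tree_value S b - \sum_j L b j * (T * tnth t j))) a)).
  by apply: eq_bigr => a _; rewrite E.
by rewrite offsetD LP offset_tension // addr0.
Qed.

Lemma measurable_cell_point S L a : measurable_fun setT ((cell_point S L)^~ a).
Proof.
have mlin b : measurable_fun setT (fun t : n.-tuple RR => \sum_j L b j * (T * tnth t j)).
  apply: measurable_sum => j; apply: measurable_funM; first exact: measurable_cst.
  by apply: measurable_funM; [exact: measurable_cst|exact: measurable_tnth].
apply: measurable_funD => //.
under eq_fun do rewrite big_mkcond.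
apply: measurable_sum => b; case: (val b \in S); last exact: measurable_cst.
apply: measurable_funM; last exact: measurable_cst.
by apply: measurable_funB => //; exact: measurable_cst.
Qed.

(** By [offset_inj] the witness can only be [cell_point], so only the cotree conditions remain. They
    exhibit the cell as a finite intersection of preimages of intervals. *)
Lemma cellE S L : spanning_tree S ->
  (forall (t : 'I_n -> R) i, offset B i (fun a => \sum_j L a j * t j) = t i) ->
  cell S = [set t | forall a, val a \notin S -> cell_point S L t a \in cotree_itv S a].
Proof.
move=> hS LP; apply/seteqP; split => t.
  move=> [x xS xt] a aS; have [yo yS] := cell_pointP t hS LP.
  have -> : cell_point S L t a = x a.
    apply: (offset_inj simpleG antiG hB hS) => [i|b bS]; first by rewrite yo xt.
    by rewrite yS //; have := xS b; rewrite bS => ->.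
  by have := xS a; rewrite (negPf aS).
have [yo yS] := cell_pointP t hS LP.
move=> tS; exists (cell_point S L t) => // a.
by case: ifPn => aS; [exact: yS|exact: tS].
Qed.

Lemma measurable_cell S : spanning_tree S -> measurable (cell S).
Proof.
move=> hS; have [L LP] := offset_surj R simpleG antiG hB hS V0.
rewrite (cellE hS LP).
apply: measurable_forall => a; have [aS|aS] := boolP (val a \in S).
  by rewrite [X in measurable X](_ : _ = setT) //; apply/seteqP.
rewrite [X in measurable X](_ : _ = (cell_point S L)^~ a @^-1` [set` cotree_itv S a]);
  last first.
  by apply/seteqP; split => t //= /(_ isT).
rewrite -[X in measurable X]setTI; exact: measurable_cell_point.
Qed.

Lemma cotree_itv_round S a (y : R) : exists m : int, y + e * m%:~R \in cotree_itv S a.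
Proof.
rewrite /cotree_itv; case: ifP => _.
  exists (- Num.floor ((y - l a) / e)); rewrite in_itv /=.
  have /andP[] := floor_itv ((y - l a) / e).
  rewrite ler_pdivlMr // ltr_pdivrMr // intrD intrN; nra.
(* The interval is open below, so the rounding uses the ceiling; adding [1 - ceil] puts the quotient
   into []0, 1]]. *)
exists (1 - Num.ceil ((y - l a) / e)); rewrite in_itv /=.
have /andP[] := ceil_itv ((y - l a) / e).
rewrite ltr_pdivlMr // ler_pdivrMr // !intrB; nra.
Qed.

(** Cycles have integer entries, so moving cotree coordinates by integer multiples of [e] changes
    the offsets by integer multiples of [e]. Each cotree coordinate is rounded into its interval,
    and the tree coordinates stay put. *)
Lemma cell_cover S (t : n.-tuple RR) : spanning_tree S ->
  exists k : n.-tuple int, cell S (tshift [tuple e / T * (tnth k i)%:~R | i < n] t).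
Proof.
move=> hS; have [L LP] := offset_surj R simpleG antiG hB hS V0.
have [yo yS] := cell_pointP t hS LP.
pose y := cell_point S L t.
have /choice[m mP] : forall a, exists m : int,
    if val a \in S then m = 0 else y a + e * m%:~R \in cotree_itv S a.
  move=> a; case: (val a \in S); first by exists 0.
  exact: cotree_itv_round.
exists [tuple \sum_a tnth B i a * m a | i < n].
exists (fun a => y a + e * (m a)%:~R) => [a|i].
  have := mP a; case: ifP => // aS ->; rewrite mulr0 addr0; exact: yS.
rewrite offsetD yo !tnth_mktuple mulrDr addrC; congr (_ + _).
rewrite mulrA mulrCA divff ?gt_eqF // mulr1 rmorph_sum mulr_sumr.
by apply: eq_bigr => a _; rewrite mulrCA rmorphM.
Qed.

Lemma cell_volume S : spanning_tree S -> (((e / T) ^+ n)%:E <= lebesgue_tuple (cell S))%E.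
Proof.
move=> hS; apply: covering_volume; first by rewrite divr_gt0.
  exact: measurable_cell.
by move=> t; exact: cell_cover.
Qed.

(** The cells of distinct trees are disjoint by [cell_tree_unique], so their volumes add up inside
    [A]. *)
Lemma cells_volume (A : set (n.-tuple RR)) :
  (forall S, spanning_tree S -> cell S `<=` A) ->
  ((#|spanning_trees G|%:R * (e / T) ^+ n)%:E <= lebesgue_tuple A)%E.
Proof.
move=> SA.
have treeP S : S \in spanning_trees G -> spanning_tree S.
  by rewrite inE => /asboolP.
pose C (k : 'I_#|spanning_trees G|) := cell (enum_val k).
have treeC (k : 'I_#|spanning_trees G|) : spanning_tree (enum_val k).
  by apply: treeP; exact: (enum_valP k).
have mC k : measurable (C k) by exact: measurable_cell.
have dC : trivIset setT C.
  apply/trivIsetP => i j _ _; apply: contraNeq => /set0P[t [ti tj]].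
  by apply/eqP/enum_val_inj; exact: cell_tree_unique ti tj.
apply: (@le_trans _ _ (lebesgue_tuple (\big[setU/set0]_k C k))); last first.
  apply: le_lebesgue_tuple => t; rewrite -bigcup_seq => -[k _].
  by apply: SA; exact: treeC.
rewrite measure_semi_additive_ord //; last exact: bigsetU_measurable.
apply: (@le_trans _ _ (\sum_(k < #|spanning_trees G|) ((e / T) ^+ n)%:E)%E).
  by rewrite sumEFin sumr_const card_ord lee_fin mulr_natl.
by apply: lee_sum => k _; exact: cell_volume.
Qed.

End Cells.

(** * Two-connectivity and width *)

Section TwoConnected.
Variable G : digraph.
Hypotheses (simpleG : simple_graph G) (antiG : no_antiparallel G).
Hypothesis conn2 : two_connected G.

(** Ensures that [min_span] is a genuine minimum and not its default value 0. *)
Lemma two_connected_arc : inhabited (arc_type G).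
Proof.
have [V2 conn] := conn2.
have /card_gt1P[x [y [_ _ xy]]] : (1 < #|vertex G|)%N by exact: ltnW.
have notin0 (z : vertex G) : z \notin finset.set0 by rewrite inE.
have := conn finset.set0 (_ : #|finset.set0| < 2)%N.
rewrite cards0 => /(_ isT x y (notin0 x) (notin0 y)).
case/connectP => -[|z p] /=; first by move=> _ yx; rewrite yx eqxx in xy.
case/andP => /andP[/orP[h|h] _] _ _; first exact: inhabits (Sub (x, z) h).
exact: inhabits (Sub (z, x) h).
Qed.

Lemma two_connected_bridgeless (a : arc_type G) :
  connect (adj (arcs G :\ val a)%SET) (target a) (source a).
Proof.
have [V2 conn] := conn2.
have /existsP[k] : [exists k, k \notin [set source a; target a]%SET].
  rewrite -negb_forall; apply/negP => /forallP kst.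
  have : (#|[set: vertex G]%SET| <= #|[set source a; target a]%SET|)%N.
    by apply: subset_leq_card; apply/fintype.subsetP => k _; exact: kst.
  by rewrite cardsT cards2; case: (_ != _) => h; have := leq_trans V2 h.
rewrite !inE negb_or => /andP[ks kt].
have st : source a != target a.
  by apply/eqP => E; have := arc_valP a; rewrite E (negPf (simpleG _)).
have avoid w x y : w = source a \/ w = target a -> x != w -> y != w ->
    connect (adj (arcs G :\ val a)%SET) x y.
  move=> hw xw yw; have := conn [set w]%SET; rewrite cards1 => /(_ isT x y).
  rewrite !inE => /(_ xw yw); apply: connect_sub => u v /= /and3P[uv].
  rewrite !inE => uw vw; apply: connect1; move: uv.
  rewrite /adj !inE arc_endpoints !xpair_eqE.
  by case: hw uw vw => -> /negPf-> /negPf->; rewrite ?andbF ?andFb.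
(* The detour through a third vertex [k] avoids the edge because each half avoids
   one of its ends. *)
apply: (@connect_trans _ _ k).
  by apply: (avoid (source a)) => //; [left|rewrite eq_sym].
by apply: (avoid (target a)) => //; right.
Qed.

Lemma oriented_cycle_neq0 g : oriented_cycle G g -> exists a, g a != 0.
Proof.
move=> [_ _ [p [sp /andP[cp up] E]]].
case: p sp cp up E => // x p sp cp up E.
have xp : x \in x :: p by exact: mem_head.
have [a aE] : exists a : arc_type G,
    (source a \in x :: p) && (target a == next (x :: p) (source a))
    || (target a \in x :: p) && (source a == next (x :: p) (target a)).
  have /orP[h|h] := next_cycle cp xp.
    by exists (Sub (x, _) h); rewrite /source /target SubK xp eqxx.
  by exists (Sub (_, x) h); rewrite /source /target SubK xp eqxx orbT.
have : val a \in [set val a | a in [set a | g a != 0]%SET]%SET.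
  by rewrite E inE (valP a).
by case/imsetP => b; rewrite inE => gb _; exists b.
Qed.

(** Every arc lies on an oriented cycle, which an empty basis could not generate. The strict last
    inequality needs this, since empty products would be equal. *)
Lemma cyclomatic_gt0 (B : (cyclomatic G).-tuple (arc_vector G)) :
  integral_cycle_basis B -> (0 < cyclomatic G)%N.
Proof.
move=> [_ spanB]; have [a] := two_connected_arc.
have [||g [gc ga _]] := cycle_through simpleG antiG _ _ (two_connected_bridgeless a).
- exact: finset.subsetDl.
- by rewrite !inE eqxx.
rewrite lt0n; apply/eqP => n0; case/eqP: ga.
have [m [x [k [xB ->]]]] : zspan [set` B] g.
  rewrite spanB; exists 1, (fun=> g), (fun=> 1); split=> //.
  by rewrite big_ord1 mulr1z.
case: m x k xB => [|m] x k xB; first by rewrite big_ord0 ffunE.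
have xB0 : x ord0 \in tval B by exact: (xB ord0).
have /size0nil B0 : size B = 0%N by rewrite size_tuple n0.
by rewrite B0 in xB0.
Qed.

End TwoConnected.

(** * Cycle spans compared with the width *)

Section Width.
Variables (R : realType) (P : pesp R).
Hypothesis bounds : forall a : arc_type P,
  [/\ 0 <= lower a, lower a < (period P)%:R,
      0 < upper a - lower a & upper a - lower a < (period P)%:R].
Local Notation T := ((period P)%:R : R).
Implicit Types (g : arc_vector P).

(** The numbers that [width_factor] rounds down and up; all offsets of [g] lie between [offset_lo g]
    and [offset_hi g]. *)
Definition offset_hi g : R := (\sum_a (pos_part g a)%:~R * upper a
              - \sum_a (neg_part g a)%:~R * lower a) / T.
Definition offset_lo g : R := (\sum_a (pos_part g a)%:~R * lower a
              - \sum_a (neg_part g a)%:~R * upper a) / T.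

Let T0 : 0 < T. Proof. by rewrite ltr0n; exact: period_gt0. Qed.

Lemma part_cases g a : oriented_cycle P g ->
  [\/ [/\ g a = -1, pos_part g a = 0 & neg_part g a = 1],
      [/\ g a = 0, pos_part g a = 0 & neg_part g a = 0] |
      [/\ g a = 1, pos_part g a = 1 & neg_part g a = 0]].
Proof.
move=> [/(_ a) + _ _]; rewrite /pos_part /neg_part !inE => /or3P[] /eqP ->.
- by constructor 1.
- by constructor 2.
- by constructor 3.
Qed.

Lemma offset_hi_sub_lo g : oriented_cycle P g -> offset_hi g - offset_lo g = cycle_span g.
Proof.
move=> gc; rewrite /offset_hi /offset_lo /cycle_span -mulrBl -!sumrB [RHS]big_mkcond mulr_suml.
apply: eq_bigr => a _.
by case: (part_cases a gc) => -[-> -> ->]; rewrite ?eqxx /=; ring.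
Qed.

Lemma cycle_span_gt0 g : oriented_cycle P g -> 0 < cycle_span g.
Proof.
move=> gc; have [a ga] := oriented_cycle_neq0 gc.
rewrite /cycle_span (bigD1 a) //=; apply: ltr_wpDr.
  by apply: sumr_ge0 => b _; rewrite divr_ge0 ?ltW //; have [] := bounds b.
by rewrite divr_gt0 //; have [] := bounds a.
Qed.

Lemma offset_itv g (x : arc_type P -> R) : oriented_cycle P g ->
  (forall a, lower a <= x a <= upper a) ->
  (\sum_a (g a)%:~R * x a) / T \in `[offset_lo g, offset_hi g].
Proof.
move=> gc xb; rewrite in_itv /= /offset_lo /offset_hi !ler_pM2r ?invr_gt0 // -!sumrB.
by apply/andP; split; apply: ler_sum => a _; have /andP[] := xb a;
  case: (part_cases a gc) => -[-> -> ->]; lra.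
Qed.

(** Each rounding loses less than 1, so the factor exceeds the span minus 1, and both sides are
    integers. *)
Lemma floor_width_factor g : oriented_cycle P g -> Num.floor (cycle_span g) <= width_factor g.
Proof.
move=> gc; rewrite /width_factor -/(offset_hi g) -/(offset_lo g) -offset_hi_sub_lo //.
have /andP[h1 h2] := floor_itv (offset_hi g); have /andP[c1 c2] := ceil_itv (offset_lo g).
have /andP[s1 s2] := floor_itv (offset_hi g - offset_lo g).
rewrite -ltzD1 -(ltr_int R) !intrD !intrN; move: h1 h2 c1 c2 s1 s2.
rewrite !intrD !intrN; lra.
Qed.

(** Factors are nonnegative integers because spans are positive; a product of at least 1 then
    excludes a zero factor. *)
Lemma width_factor_ge (B : (cyclomatic P).-tuple (arc_vector P)) i :
  (forall j, oriented_cycle P (tnth B j)) -> 1 <= width B ->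
  Num.max (Num.floor (cycle_span (tnth B i))) 1 <= width_factor (tnth B i).
Proof.
move=> Bc W1; rewrite ge_max floor_width_factor //=.
have ge0 : 0 <= width_factor (tnth B i).
  apply: le_trans (floor_width_factor (Bc i)).
  by rewrite floor_ge0 ltW // cycle_span_gt0.
have : width_factor (tnth B i) != 0.
  apply: contraTneq W1 => w0; rewrite /width big_tuple (bigD1 i) //= w0 mul0r.
  by [].
by rewrite neq_lt ltNge ge0 /= -gtz0_ge1.
Qed.

Lemma max_floor_gt0 (s : R) : 0 < (Num.max (Num.floor s) 1)%:~R :> R.
Proof. by rewrite ltr0z lt_max ltr01 orbT. Qed.

(** [s] is below [floor s + 1], and both summands are at most the denominator. *)
Lemma span_ratio_lt2 (s : R) : s / (Num.max (Num.floor s) 1)%:~R < 2.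
Proof.
rewrite ltr_pdivrMr ?max_floor_gt0 //.
have /andP[_] := floor_itv s; rewrite intrD => h.
have : (Num.floor s)%:~R <= (Num.max (Num.floor s) 1)%:~R :> R by rewrite ler_int le_max lexx.
have : 1 <= (Num.max (Num.floor s) 1)%:~R :> R by rewrite ler1z le_max lexx orbT.
by lra.
Qed.

Lemma min_span_le (a : arc_type P) : min_span P <= upper a - lower a.
Proof.
rewrite /min_span; case: pickP => [a0 _|/(_ a)//].
exact: bigmin_le_cond.
Qed.

Lemma min_span_gt0 (a : arc_type P) : 0 < min_span P.
Proof.
rewrite /min_span; case: pickP => [a0 _|/(_ a)//].
apply/bigmin_gtP; split=> [|b _]; first by have [] := bounds a0.
by have [] := bounds b.
Qed.

End Width.

Theorem theorem4p30 (R : realType) (P : pesp R) (hP : standing_assumptions P)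
    (B : (cyclomatic P).-tuple (arc_vector P)) (hB : integral_cycle_basis B)
    (hW : 1 <= width B) :
  [/\ ((#|spanning_trees P|%:R * (min_span P / (period P)%:R) ^+ cyclomatic P)%:E
         <= lebesgue_tuple (zonotope B))%E,
      (lebesgue_tuple (zonotope B) <= (\prod_(g <- B) cycle_span g)%:E)%E,
      \prod_(g <- B) cycle_span g
        <= (width B)%:~R
           * \prod_(g <- B) (cycle_span g / (Num.max (Num.floor (cycle_span g)) 1)%:~R) &
      (width B)%:~R
        * \prod_(g <- B) (cycle_span g / (Num.max (Num.floor (cycle_span g)) 1)%:~R)
        < (width B)%:~R * 2 ^+ cyclomatic P].
Proof.
have [simpleG antiG conn2 bounds] := hP.
have Bc : forall i, oriented_cycle P (tnth B i) by case: hB.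
have T0 : 0 < (period P)%:R :> R by rewrite ltr0n; exact: period_gt0.
have [a0] := two_connected_arc conn2.
have V0 : (0 < #|vertex P|)%N by case: conn2 => /ltnW/ltnW.
split.
(* One family indexed by tree and arc collects both genericity conditions: nonzero pairings with
   fundamental cuts and nonzero slacks of cotree arcs. *)
- pose phi (j : {set vertex P * vertex P} * arc_type P) (x : arc_type P -> R) :=
    if val j.2 \in j.1 then \sum_a x a * fund_cut R j.1 j.2 a
    else x j.2 - tension (potential j.1 x) j.2.
  have [|h hgen] := @generic_vector R _ _ (fun j => `[< spanning_tree j.1 >]) phi.
    move=> [S a] /= /asboolP hS; rewrite /phi /=; case: (boolP (val a \in S)) => aS.
      exists (fund_cut R S a); split; last by move=> x; apply: eq_bigr => b _; rewrite mulrC.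
      by exists a; rewrite (fund_cut_diag simpleG antiG) ?oner_neq0.
    have [c [ca cE]] := cotree_slack_linear R aS.
    by exists c; split=> //; exists a.
  (* The cells use intervals of length [min_span P] starting at [lower], which fit into the given
     ones, so every cell lies in the zonotope. *)
  apply: (cells_volume simpleG antiG V0 hB T0 (min_span_gt0 bounds a0)
    (l := @lower _ P) (h := h)).
  + move=> S b hS bS; have := hgen (S, b); rewrite /phi /= bS; apply.
    exact/asboolP.
  + move=> S b hS bS; have := hgen (S, b); rewrite /phi /= (negPf bS); apply.
    exact/asboolP.
  + move=> S hS t [x xS xt]; exists x.
      move=> a; have /andP[-> xu] := in_cell_bound (min_span_gt0 bounds a0) a xS.
      by apply: le_trans xu _; rewrite -lerBrDl min_span_le.
    apply: eq_from_tnth => i; rewrite tnth_mktuple.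
    rewrite -[X in X / _]/(offset B i x) (xt i) mulrAC divff ?mul1r //.
    by rewrite gt_eqF.
- rewrite big_tuple.
  rewrite -(@lebesgue_tuple_itv R _
    (fun i => `[offset_lo (tnth B i), offset_hi (tnth B i)])).
    apply: le_lebesgue_tuple => t [x xb <-] i; rewrite tnth_mktuple.
    exact: offset_itv.
  move=> i; have := cycle_span_gt0 bounds (Bc i).
  rewrite -offset_hi_sub_lo // subr_gt0 => lohi.
  by rewrite lebesgue_measure_itv /= lte_fin lohi -EFinB.
(* With the product of the spans factored out, it remains to bound the product of the maxima by the
   width, factor by factor. *)
- rewrite prodf_div mulrCA -[leLHS]mulr1 ler_wpM2l //.
    by rewrite big_tuple prodr_ge0 // => i _; rewrite ltW // cycle_span_gt0.
  have m0 : 0 < \prod_(g <- B) (Num.max (Num.floor (cycle_span g)) 1)%:~R :> R.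
    by apply: prodr_gt0 => g _; exact: max_floor_gt0.
  rewrite ler_pdivlMr // mul1r -rmorph_prod ler_int /width !big_tuple.
  apply: ler_prod => i _; rewrite width_factor_ge // andbT.
  by rewrite le_max ler01 orbT.
- rewrite ltr_pM2l; last by rewrite ltr0z (lt_le_trans ltr01).
  have -> : 2 ^+ cyclomatic P = \prod_(i < cyclomatic P) 2 :> R.
    by rewrite prodr_const card_ord.
  rewrite big_tuple; apply: ltr_prod.
    apply/hasP; exists (Ordinal (cyclomatic_gt0 simpleG antiG conn2 hB)) => //.
  move=> i _; rewrite span_ratio_lt2 andbT divr_ge0 // ltW //.
    exact: cycle_span_gt0.
  exact: max_floor_gt0.
Qed.
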